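(* Let $p$ be a prime and let $n,k$ be integers with $0\le k<n$ (so $n\ge 1$). Write $n=\sum_i n_i p^i$ and $k=\sum_i k_i p^i$ in base $p$ (digits $n_i,k_i\in\{0,\dots,p-1\}$), where the digit sequence of $k$ is padded with zeros ($k_i=0$ whenever $p^i>k$) so that it has the same length as that of $n$. Let $\omega=\omega_p(n)$ be the exponent of the largest power of $p$ dividing $n$. Let $$N(n,k)=\frac{1}{n}\binom{n}{k}\binom{n}{k+1}.$$ Then $p\nmid N(n,k)$ if and only if one of the following two conditions holds: 1. $p\nmid n$ and (a) $k_i\le n_i$ for all $i$, and (b) $k_j<n_j$, where $j$ is the first (smallest) index with $k_j\ne p-1$ (if such an index exists). 2. $p\mid n$ and (a) $k_i\le n_i$ for all $i>\omega$, and (b) $k_\omega<n_\omega$, and (c) $k_0=k_1=\cdots=k_{\omega-1}=0$ if $p\mid k$, and $k_0=k_1=\cdots=k_{\omega-1}=p-1$ if $p\nmid k$.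
   Context: $N(n,k)$ (for $0\le k<n$) are the Narayana numbers. For a prime $p$ and positive integer $n$, $\omega_p(n)$ denotes the largest integer $e$ with $p^e\mid n$. *)

(* Defs.v *)
From mathcomp Require Import all_boot.

Set Implicit Arguments.
Unset Strict Implicit.
Unset Printing Implicit Defensive.

(* The truncated division is exact, see [narayanaE]. *)
Definition narayana (n k : nat) : nat := ('C(n, k) * 'C(n, k.+1)) %/ n.

Lemma narayanaE (n k : nat) : n * narayana n k = 'C(n, k) * 'C(n, k.+1).
Proof.
case: n => [|m]; first by rewrite mul0n bin0n muln0.
rewrite /narayana mulnC divnK //.
have hk1 : m.+1 %| k.+1 * ('C(m.+1, k) * 'C(m.+1, k.+1)).
  by rewrite mulnCA -mul_bin_diag mulnCA dvdn_mulr.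
have hk : m.+1 %| k * ('C(m.+1, k) * 'C(m.+1, k.+1)).
  case: k {hk1} => [|k]; first by rewrite mul0n.
  by rewrite mulnA -mul_bin_diag -mulnA dvdn_mulr.
by move: hk1; rewrite mulSn dvdn_addl.
Qed.

Definition digit (p m i : nat) : nat := m %/ p ^ i %% p.

(* The number of base-p digits of m; meaningful for 1 < p and 0 < m. *)
Definition ndigits (p m : nat) : nat := (trunc_log p m).+1.

Lemma ltn_digit (p m i : nat) : 1 < p -> digit p m i < p.
Proof. by move=> p_gt1; rewrite ltn_mod ltnW. Qed.

Lemma digit_expansion (p m l : nat) :
  1 < p -> m < p ^ l -> m = \sum_(i < l) digit p m i * p ^ i.
Proof.
move=> p_gt1; elim: l m => [|l IHl] m lt_m.
  by rewrite big_ord0; case: m lt_m.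
rewrite big_ord_recl /digit expn0 divn1 muln1.
rewrite {1}(divn_eq m p) addnC; congr (_ + _).
have lt_q : m %/ p < p ^ l by rewrite ltn_divLR ?(ltnW p_gt1) // -expnSr.
rewrite {1}(IHl _ lt_q) big_distrl /=; apply: eq_bigr => i _.
by rewrite /digit /bump leq0n add1n expnS divnMA -mulnA [p ^ i * p]mulnC.
Qed.

Lemma ndigits_expansion (p n k : nat) : 1 < p -> k <= n ->
  k = \sum_(i < ndigits p n) digit p k i * p ^ i.
Proof.
move=> p_gt1 le_kn; apply: digit_expansion => //.
by apply: leq_ltn_trans le_kn _; apply: trunc_log_ltn.
Qed.

Lemma ndigits_lead (p n : nat) : 1 < p -> 0 < n ->
  0 < digit p n (ndigits p n).-1.
Proof.
move=> p_gt1 n_gt0; rewrite /digit /ndigits /=.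
rewrite modn_small; first by rewrite divn_gt0 ?expn_gt0 ?(ltnW p_gt1) ?trunc_logP.
by rewrite ltn_divLR ?expn_gt0 ?(ltnW p_gt1) // -expnS trunc_log_ltn.
Qed.

(* Main.v *)
Require Import Defs.
From mathcomp Require Import all_boot.
From mathcomp Require Import zify.

Set Implicit Arguments.
Unset Strict Implicit.
Unset Printing Implicit Defensive.

(** By Kummer's theorem, [p] does not divide [C(n, k)] iff the base-[p] digits
    of [k] are dominated by those of [n].  If [p] does not divide [n], then [p]
    is coprime to [N(n, k)] iff it is coprime to both [C(n, k)] and
    [C(n, k+1)].  If [p] divides [n], the factor [1/n] is absorbed using
    [(k+1) N(n, k) = C(n, k) C(n-1, k)] when [p] divides [k], and
    [k N(n, k) = C(n-1, k-1) C(n, k+1)] otherwise.  It remains to compare the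
    digits of [n-1], [k-1], [k+1] with those of [n] and [k]. *)

(** Subtract Legendre's formulas for [a!] and [b!] from that for [(a + b)!]: by [divnD] the [i]-th
    terms differ by 1 exactly when a carry leaves the last [i] digits. *)
Lemma logn_bin_carries (p a b : nat) : prime p ->
  logn p 'C(a + b, a) =
  \sum_(1 <= i < (a + b).+1) (p ^ i <= a %% p ^ i + b %% p ^ i).
Proof.
move=> p_pr; have p_gt1 := prime_gt1 p_pr.
(* All three Legendre sums are put over one range; the added terms vanish because [c < p ^ i]
   there. *)
have widen c : c <= a + b ->
    logn p c`! = \sum_(1 <= i < (a + b).+1) c %/ p ^ i.
  move=> le_c; rewrite logn_fact // [RHS](big_cat_nat _ (n := c.+1)) //=.
  rewrite [X in _ + X]big_nat_cond [X in _ + X]big1 ?addn0 // => i.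
  case/andP=> /andP[lt_ci _] _.
  by rewrite divn_small // (ltn_trans lt_ci) // ltn_expl.
have := bin_fact (leq_addr b a); rewrite addKn => /(congr1 (logn p)).
rewrite !lognM ?muln_gt0 ?fact_gt0 ?bin_gt0 ?leq_addr //.
rewrite !widen ?leq_addr ?leq_addl //.
have pX_gt0 i : 0 < p ^ i by rewrite expn_gt0 ltnW.
rewrite [RHS](eq_bigr _ (fun i _ => divnD a b (pX_gt0 i))).
by rewrite !big_split /=; lia.
Qed.

(** A carry subtracts [d] from the sum of residues, and [b %% d < d], so the result drops below
    [a %% d]; without a carry it cannot. *)
Lemma carry_modE (d a b : nat) : 0 < d ->
  (d <= a %% d + b %% d) = ~~ (a %% d <= (a + b) %% d).
Proof.
move=> d_gt0; rewrite modnD //.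
have := ltn_pmod a d_gt0; have := ltn_pmod b d_gt0.
by case: leqP; lia.
Qed.

Lemma prime_ndvd_bin_mod (p n k : nat) : prime p -> k <= n ->
  ~ (p %| 'C(n, k)) <-> forall i, k %% p ^ i <= n %% p ^ i.
Proof.
move=> p_pr le_kn; have p_gt1 := prime_gt1 p_pr.
have pX_gt0 i : 0 < p ^ i by rewrite expn_gt0 ltnW.
have -> : (p %| 'C(n, k)) = (0 < logn p 'C(n, k)).
  by rewrite logn_gt0 mem_primes p_pr bin_gt0 le_kn.
rewrite -{1}(subnKC le_kn) logn_bin_carries // subnKC //.
split=> [/negP|le_mod]; last first.
  by rewrite big1 // => i _; rewrite carry_modE // subnKC // le_mod.
rewrite -eqn0Ngt sum_nat_seq_eq0 => /allP no_carry i.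
(* The carry count only covers [1 <= i <= n]. For [i = 0] residues are 0, and for [i > n] they are
   [k] and [n] themselves. *)
case: (posnP i) => [->|i_gt0]; first by rewrite expn0 !modn1.
case: (leqP i n) => [le_in|lt_ni]; last first.
  have lt_nX : n < p ^ i by rewrite (ltn_trans lt_ni) // ltn_expl.
  by rewrite !modn_small // (leq_ltn_trans le_kn).
have /no_carry : i \in index_iota 1 n.+1 by rewrite mem_index_iota i_gt0.
by rewrite /= carry_modE // subnKC // eqb0 negbK.
Qed.

Lemma modn_expS_digit (p m i : nat) : 0 < p ->
  m %% p ^ i.+1 = digit p m i * p ^ i + m %% p ^ i.
Proof.
move=> p_gt0; have pX_gt0 : 0 < p ^ i by rewrite expn_gt0 p_gt0.
rewrite /digit {1}(divn_eq m (p ^ i)) {1}(divn_eq (m %/ p ^ i) p).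
rewrite mulnDl -mulnA -expnS -addnA modnMDl modn_small // expnS.
have := ltn_pmod m pX_gt0; have := ltn_pmod (m %/ p ^ i) p_gt0; nia.
Qed.

(** Digit [i] is the leading digit of the residue modulo [p ^ i.+1], so comparing residues compares
    leading digits; conversely, digitwise bounds add up to bounds on residues. *)
Lemma prime_ndvd_bin_digit (p n k : nat) : prime p -> k <= n ->
  ~ (p %| 'C(n, k)) <-> forall i, digit p k i <= digit p n i.
Proof.
move=> p_pr le_kn; have p_gt0 := prime_gt0 p_pr.
rewrite prime_ndvd_bin_mod //; split=> [le_mod i | le_dig].
  have := le_mod i.+1; rewrite !modn_expS_digit //.
  have pX_gt0 : 0 < p ^ i by rewrite expn_gt0 p_gt0.
  have := ltn_pmod k pX_gt0; have := ltn_pmod n pX_gt0; nia.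
elim=> [|i IHi]; first by rewrite expn0 !modn1.
by rewrite !modn_expS_digit // leq_add // leq_mul2r le_dig orbT.
Qed.

Lemma digit_small (p n m i : nat) : 1 < p -> m <= n -> ndigits p n <= i ->
  digit p m i = 0.
Proof.
move=> p_gt1 le_mn le_i; rewrite /digit divn_small ?mod0n //.
apply: leq_ltn_trans le_mn _; apply: leq_trans (trunc_log_ltn n p_gt1) _.
by rewrite leq_exp2l.
Qed.

Lemma digit_eq0 (p m i : nat) : p ^ i %| m ->
  (digit p m i == 0) = (p ^ i.+1 %| m).
Proof. by move=> dv_m; rewrite expnS -dvdn_divRL. Qed.

Variant digit_succ_spec (p m v : nat) : Prop :=
  DigitSuccSpec of
    (forall i, i < v -> digit p m i = p.-1) &
    (forall i, i < v -> digit p m.+1 i = 0) &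
    digit p m.+1 v = (digit p m v).+1 &
    (forall i, v < i -> digit p m.+1 i = digit p m i).

(** Adding 1 to [m] carries into position [i] iff [p ^ i] divides [m.+1], i.e. iff [i <= v]. Hence
    [v] is the length of the run of trailing digits [p.-1] of [m]. *)
Lemma digit_succP (p m : nat) : prime p ->
  digit_succ_spec p m (logn p m.+1).
Proof.
move=> p_pr; have p_gt1 := prime_gt1 p_pr; set v := logn p m.+1.
have dvE i : (p ^ i %| m.+1) = (i <= v) by rewrite pfactor_dvdn.
have digE i : digit p m.+1 i = (digit p m i + (i <= v)) %% p.
  by rewrite -dvE /digit divnS ?expn_gt0 ?prime_gt0 // modnDml addnC.
have dig_lt i := ltn_digit m i p_gt1.
have dig0 i : i <= v -> (digit p m.+1 i == 0) = (i < v).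
  by move=> le_iv; rewrite digit_eq0 dvE.
have succ_full i : i <= v -> digit p m i = p.-1 -> digit p m.+1 i = 0.
  by move=> le_iv dig_i; rewrite digE le_iv dig_i addn1 prednK ?modnn // ltnW.
have succ_lt i : i <= v -> digit p m i <> p.-1 ->
    digit p m.+1 i = (digit p m i).+1.
  move=> le_iv dig_i; rewrite digE le_iv addn1 modn_small //.
  by have := dig_lt i; lia.
split=> [i lt_iv|i lt_iv||i lt_vi].
- apply/eqP/negPn/negP => /eqP /(succ_lt _ (ltnW lt_iv)) dig_i.
  by have := dig0 i (ltnW lt_iv); rewrite lt_iv dig_i.
- by apply/eqP; rewrite dig0 // ltnW.
- apply: succ_lt => // /(succ_full _ (leqnn v)) dig_v.
  by have := dig0 v (leqnn v); rewrite ltnn dig_v eqxx.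
- by rewrite digE leqNgt lt_vi addn0 modn_small.
Qed.

Lemma mulSn_narayana (n k : nat) : 0 < n ->
  k.+1 * narayana n k = 'C(n, k) * 'C(n.-1, k).
Proof.
move=> n_gt0; apply/eqP; rewrite -(eqn_pmul2l n_gt0); apply/eqP.
by rewrite mulnCA narayanaE mulnCA -mul_bin_diag mulnCA.
Qed.

Lemma muln_narayanaS (n k : nat) : 0 < n ->
  k.+1 * narayana n k.+1 = 'C(n.-1, k) * 'C(n, k.+2).
Proof.
move=> n_gt0; apply/eqP; rewrite -(eqn_pmul2l n_gt0); apply/eqP.
by rewrite mulnCA narayanaE !mulnA mul_bin_diag.
Qed.

Lemma prime_ndvdM (p a b : nat) : prime p ->
  ~ (p %| a * b) <-> ~ (p %| a) /\ ~ (p %| b).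
Proof.
move=> p_pr; rewrite Euclid_dvdM //; split.
  by move/negP; rewrite negb_or => /andP[/negP ? /negP].
by case=> ? ? /orP[].
Qed.

(** Given that [n] dominates [k], dominating [k.+1] is a new condition only at the position [v]
    where the carry stops; this [v] is the index [j] of the statement. *)
Lemma narayana_ndvd_coprime (p n k : nat) : prime p -> k < n -> ~ (p %| n) ->
  ~ (p %| narayana n k) <->
  (forall i, i < ndigits p n -> digit p k i <= digit p n i) /\
  (forall j, j < ndigits p n -> digit p k j <> p.-1 ->
     (forall i, i < j -> digit p k i = p.-1) -> digit p k j < digit p n j).
Proof.
move=> p_pr lt_kn ndv_n; have p_gt1 := prime_gt1 p_pr.
have -> : ~ (p %| narayana n k) <-> ~ (p %| 'C(n, k) * 'C(n, k.+1)).
  by rewrite -narayanaE prime_ndvdM //; tauto.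
rewrite prime_ndvdM // !prime_ndvd_bin_digit ?(ltnW lt_kn) //.
have [k_lo kS_lo kS_v kS_hi] := digit_succP k p_pr.
set v := logn p k.+1 in k_lo kS_lo kS_v kS_hi.
have kS_lt := ltn_digit k.+1 v p_gt1.
split=> [[le_k le_kS]|[le_k lt_j]].
  split=> // j _ k_j k_ltj; suff -> : j = v by rewrite -kS_v.
  case: (ltngtP j v) => // [/k_lo //|lt_vj].
  by move: kS_lt; rewrite kS_v k_ltj //; lia.
have le_k' i : digit p k i <= digit p n i.
  case: (ltnP i (ndigits p n)) => [/le_k //|].
  by move/(digit_small p_gt1 (ltnW lt_kn)) ->.
split=> // i; case: (ltngtP i v) => [/kS_lo -> //|/kS_hi -> //|->].
rewrite kS_v; apply: lt_j => //; last by move: kS_lt; rewrite kS_v; lia.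
(* Position [v] lies within the digits of [n]: [k.+1 <= n] has a nonzero digit there. *)
rewrite ltnNge; apply/negP => /(digit_small p_gt1 lt_kn).
by rewrite kS_v.
Qed.

Lemma narayana_ndvd_dvd (p n k : nat) : prime p -> k < n -> p %| n ->
  ~ (p %| narayana n k) <->
  [/\ (forall i, logn p n < i -> i < ndigits p n ->
         digit p k i <= digit p n i),
      digit p k (logn p n) < digit p n (logn p n)
    & (p %| k -> forall i, i < logn p n -> digit p k i = 0) /\
      (~ (p %| k) -> forall i, i < logn p n -> digit p k i = p.-1)].
Proof.
case: n => // m p_pr lt_km dv_n; have p_gt1 := prime_gt1 p_pr.
have [m_lo n_lo n_w n_hi] := digit_succP m p_pr.
have w_gt0 : 0 < logn p m.+1 by rewrite logn_gt0 mem_primes p_pr.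
set w := logn p m.+1 in w_gt0 m_lo n_lo n_w n_hi *.
have hi_all : (forall i, w < i -> i < ndigits p m.+1 ->
    digit p k i <= digit p m.+1 i) ->
    forall i, w < i -> digit p k i <= digit p m.+1 i.
  move=> hi i lt_wi; case: (ltnP i (ndigits p m.+1)) => [/(hi i lt_wi) //|].
  by move/(digit_small p_gt1 (ltnW lt_km)) ->.
have [dv_k|/negP ndv_k] := boolP (p %| k).
  have ndv_kS : ~ (p %| k.+1).
    by rewrite -addn1 dvdn_addr // dvdn1 => /eqP p1; rewrite p1 in p_gt1.
  have -> : ~ (p %| narayana m.+1 k) <-> ~ (p %| 'C(m.+1, k) * 'C(m, k)).
    by rewrite -mulSn_narayana // prime_ndvdM //; tauto.
  rewrite prime_ndvdM // !prime_ndvd_bin_digit ?(ltnW lt_km) //.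
  (* Below [w] the digits of [m.+1] are 0 and those of [m] are [p.-1], so [m.+1] forces zeros in
     [k]; at [w], [m] is smaller by 1, which gives the strict inequality. *)
  split=> [[le_n le_m]|[/hi_all hi lt_w [/(_ isT) lo _]]].
    split=> [i _ _||]; first exact: le_n; first by rewrite n_w ltnS.
    split=> // _ i lt_iw.
    by apply/eqP; rewrite -leqn0 -(n_lo i).
  split=> i; case: (ltngtP i w) => [/lo -> //|lt_wi|->].
  - exact: hi.
  - exact: ltnW.
  - by rewrite -n_hi ?hi.
  - by rewrite -ltnS -n_w.
case: k lt_km ndv_k hi_all => [|k] lt_km ndv_k hi_all; first by case: ndv_k.
have -> : ~ (p %| narayana m.+1 k.+1) <-> ~ (p %| 'C(m, k) * 'C(m.+1, k.+2)).
  by rewrite -(muln_narayanaS k (ltn0Sn m)) prime_ndvdM //; tauto.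
rewrite prime_ndvdM // !prime_ndvd_bin_digit //; last exact: ltnW.
(* As [p] does not divide [k.+1], passing from [k] to [k.+1] changes only digit 0. *)
have [_ _ k_0 k_hi] := digit_succP k p_pr.
have logk0 : logn p k.+1 = 0.
  by apply/eqP; rewrite -leqn0 leqNgt logn_gt0 mem_primes p_pr; apply/negP.
rewrite {}logk0 in k_0 k_hi.
have le_k i : digit p k i <= digit p k.+1 i.
  by case: (posnP i) => [->|/k_hi -> //]; rewrite k_0.
have [k_lo kS_lo kS_v kS_hi] := digit_succP k.+1 p_pr.
set v := logn p k.+2 in k_lo kS_lo kS_v kS_hi.
have kS_lt := ltn_digit k.+2 v p_gt1.
split=> [[le_m le_n]|[/hi_all hi lt_w [_ /(_ notF) lo]]].
  split=> [i lt_wi _||]; [| |split=> // _ i lt_iw].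
  - by rewrite k_hi ?n_hi // (ltn_trans w_gt0).
  - by rewrite k_hi // n_w ltnS.
  (* If [v < w], the nonzero digit [v] of [k.+2] would exceed the zero digit of [m.+1]. *)
  - apply: k_lo; apply: (leq_trans lt_iw); rewrite leqNgt; apply/negP => lt_vw.
    by have := le_n v; rewrite kS_v n_lo.
have n_lt := ltn_digit m.+1 w p_gt1.
(* If [v < w], digit [v] of [k.+1] is [p.-1] and its successor is no digit; if [w < v], digit [w] of
   [k.+1] is [p.-1], which is not below a digit of [m.+1]. *)
have v_w : v = w.
  case: (ltngtP v w) => // [/lo k_v|/k_lo k_w]; first by move: kS_lt; lia.
  by move: lt_w; lia.
rewrite {}v_w in k_lo kS_lo kS_v kS_hi kS_lt.
split=> i; case: (ltngtP i w) => [lt_iw|lt_wi|->].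
- by rewrite m_lo // -ltnS prednK ?ltn_digit // ltnW.
- by rewrite -n_hi // (leq_trans (le_k i)) ?hi.
- by rewrite (leq_trans (le_k w)) // -ltnS -n_w.
- by rewrite kS_lo.
- by rewrite kS_hi // hi.
- by rewrite kS_v.
Qed.

Theorem theorem1p2 (p n k : nat) (p_prime : prime p) (lt_kn : k < n) :
  ~ (p %| narayana n k) <->
  [/\ ~ (p %| n),
      (forall i : nat, i < ndigits p n -> digit p k i <= digit p n i)
    & (forall j : nat, j < ndigits p n ->
         digit p k j <> p.-1 ->
         (forall i : nat, i < j -> digit p k i = p.-1) ->
         digit p k j < digit p n j)]
  \/
  [/\ p %| n,
      (forall i : nat, logn p n < i -> i < ndigits p n ->
         digit p k i <= digit p n i),
      digit p k (logn p n) < digit p n (logn p n)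
    & (p %| k -> forall i : nat, i < logn p n -> digit p k i = 0) /\
      (~ (p %| k) -> forall i : nat, i < logn p n -> digit p k i = p.-1)].
Proof.
have [dv_n|/negP ndv_n] := boolP (p %| n).
  rewrite narayana_ndvd_dvd //; split=> [[]|[[] //|[]]]; last by split.
  by right; split.
rewrite narayana_ndvd_coprime //; split=> [[]|[[]|[]]] //.
by left; split.
Qed.
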